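(* Let $D$ be a digraph on $p\ge 5$ vertices with minimum degree at least $p-1$ and minimum semi-degree at least $p/2-1$. Then: (i) $D$ contains a directed cycle of length 3, or $p=2n$ and $D\subseteq K^*_{n,n}$, or else $D$ is isomorphic to $C^*_5$ or to $K^*_{n,n+1}$ (with $p=2n+1$); (ii) $D$ contains a directed cycle of length 4, or $D$ is isomorphic to one of $C^*_5$, $H'_6$, $H''_6$, $C^*_6(1)$, $[(K_2\cup K_2)+K_1]^*$, or $D\in H(3,3)$.
   Context: Digraphs are finite, without loops or multiple arcs. For a vertex $x$, $od(x)$ and $id(x)$ are its out- and in-degree, $d(x)=od(x)+id(x)$; the minimum semi-degree is $\min_x\min\{od(x),id(x)\}$. For an undirected graph $G$, $G^*$ is the symmetric digraph obtained by replacing each edge $xy$ by arcs $xy$ and $yx$; $K_n$, $K_{n,m}$ are complete and complete bipartite graphs, $G_1\cup G_2$ is disjoint union, $G_1+G_2$ is the join. $C^*_5$ is the symmetric digraph of the undirected 5-cycle. $D\subseteq K^*_{n,n}$ means $D$ is isomorphic to a spanning subdigraph of $K^*_{n,n}$. $H(3,3)$: the set of digraphs on 6 vertices with $V=A\cup B$ (disjoint), $|A|=|B|=3$, $\langle A\rangle$ and $\langle B\rangle$ complete symmetric digraphs, no arc from $B$ to $A$, every vertex of $A$ dominates some vertex of $B$, and every vertex of $B$ is dominated by some vertex of $A$. $C^*_6(1)$: vertex set $\{x_1,\dots,x_6\}$, arcs $\{x_ix_{i+1},x_{i+1}x_i: 1\le i\le 5\}\cup\{x_1x_6,x_6x_1,x_1x_3,x_1x_5,x_2x_4,x_6x_4\}$.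 $H'_6$: vertex set $\{x,y,z,u,v,w\}$, arcs $\{ux,xu,xv,vx,yz,zy,zw,wz,xw,xy,uz,vz,wu,wv,yu,yv\}$. $H''_6$: vertex set $\{x,y,z,u,v,w\}$, arcs $\{ux,xu,xw,xy,vx,vz,vw,wv,wu,zw,zy,yz,uz,yu,yv\}$. *)

(* Defs.v *)
From mathcomp Require Import all_boot.

Set Implicit Arguments.
Unset Strict Implicit.
Unset Printing Implicit Defensive.

(* A digraph on the finite vertex type T is its arc relation e : rel T (hence
   no multiple arcs); looplessness is irreflexive e.  An undirected graph is a
   relation g : rel T read as a set of unordered pairs. *)

Section Degrees.
Variables (T : finType) (e : rel T).

Definition outdeg (x : T) : nat := #|[set y | e x y]|.
Definition indeg (x : T) : nat := #|[set y | e y x]|.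
Definition deg (x : T) : nat := outdeg x + indeg x.

(* The default values are upper bounds for the quantities minimized, so they
   only matter when T is empty. *)
Definition min_degree : nat := \big[minn/2 * #|T|]_(x : T) deg x.
Definition min_semidegree : nat :=
  \big[minn/#|T|]_(x : T) minn (outdeg x) (indeg x).

Definition has_dicycle (k : nat) : Prop := exists c : k.-tuple T, ucycle e c.

End Degrees.

Definition diso (T T' : finType) (e : rel T) (e' : rel T') : Prop :=
  exists2 f : T -> T', bijective f & {mono f : x y / e x y >-> e' x y}.

Definition iso_spanning_sub (T T' : finType) (e : rel T) (e' : rel T') : Prop :=
  exists2 s : rel T', subrel s e' & diso e s.

Definition symdi (T : finType) (g : rel T) : rel T :=
  [rel x y | g x y || g y x].

Definition complete_graph (n : nat) : rel 'I_n := [rel i j | i != j].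
Arguments complete_graph : clear implicits.

Definition cycle_graph (n : nat) : rel 'I_n :=
  [rel i j | (j == ordS i) || (i == ordS j)].
Arguments cycle_graph : clear implicits.

Definition graph_union (T1 T2 : finType) (g1 : rel T1) (g2 : rel T2) :
    rel (T1 + T2)%type :=
  fun a b => match a, b with
             | inl x, inl y => g1 x y
             | inr x, inr y => g2 x y
             | _, _ => false
             end.

Definition graph_join (T1 T2 : finType) (g1 : rel T1) (g2 : rel T2) :
    rel (T1 + T2)%type :=
  fun a b => match a, b with
             | inl x, inl y => g1 x y
             | inr x, inr y => g2 x y
             | _, _ => true
             end.

Definition complete_bipartite (n m : nat) : rel ('I_n + 'I_m)%type :=
  fun a b => match a, b with
             | inl _, inr _ | inr _, inl _ => true
             | _, _ => false
             end.
Arguments complete_bipartite : clear implicits.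

Definition in_H33 (T : finType) (e : rel T) : Prop :=
  exists A B : {set T},
    [/\ [/\ A :|: B = [set: T], [disjoint A & B], #|A| = 3 & #|B| = 3],
        {in A &, forall x y, e x y = (x != y)},
        {in B &, forall x y, e x y = (x != y)},
        {in B & A, forall b a, ~~ e b a} &
        {in A, forall a, exists2 b, b \in B & e a b} /\
        {in B, forall b, exists2 a, a \in A & e a b}].

(* Vertices are labelled 1, ..., n in the arc list. *)
Definition digraph_of_arcs (n : nat) (arcs : seq (nat * nat)) : rel 'I_n :=
  [rel i j : 'I_n | (i.+1, j.+1) \in arcs].
Arguments digraph_of_arcs : clear implicits.

Definition C6_1 : rel 'I_6 :=
  digraph_of_arcs 6
    [:: (1, 2); (2, 1); (2, 3); (3, 2); (3, 4); (4, 3); (4, 5); (5, 4);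
        (5, 6); (6, 5);
        (1, 6); (6, 1); (1, 3); (1, 5); (2, 4); (6, 4)].

Definition H6' : rel 'I_6 :=
  let x := 1 in let y := 2 in let z := 3 in
  let u := 4 in let v := 5 in let w := 6 in
  digraph_of_arcs 6
    [:: (u, x); (x, u); (x, v); (v, x); (y, z); (z, y); (z, w); (w, z);
        (x, w); (x, y); (u, z); (v, z); (w, u); (w, v); (y, u); (y, v)].

Definition H6'' : rel 'I_6 :=
  let x := 1 in let y := 2 in let z := 3 in
  let u := 4 in let v := 5 in let w := 6 in
  digraph_of_arcs 6
    [:: (u, x); (x, u); (x, w); (x, y); (v, x); (v, z); (v, w); (w, v);
        (w, u); (z, w); (z, y); (y, z); (u, z); (y, u); (y, v)].

(* Main.v *)
Require Import Defs.
From mathcomp Require Import all_boot all_order all_algebra.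
From mathcomp Require Import zify.

Set Implicit Arguments.
Unset Strict Implicit.
Unset Printing Implicit Defensive.

Import Order.TTheory GRing.Theory Num.Theory.

(** Let p be the order and write f(x,z) for the number of paths x -> v -> z.

    (i) Without 3-cycles, every arc xy satisfies In(x) /\ Out(y) = {}, so the
    degree conditions leave almost no freedom: for p = 2n + 1 either some
    semi-degree exceeds n and D is K*_{n,n+1}, or D is n-regular, hence
    symmetric, and is C*_5; for p = 2n every vertex has n neighbours, all but at
    most one of them through a 2-cycle, so the underlying graph is triangle-free
    and n-regular, hence bipartite.

    (ii) Without 4-cycles, f(x,z) and f(z,x) are both positive only if both are
    1.  If every two vertices are at distance at most 2, this bounds
    f(x,z) + f(z,x) for each pair, and summing over all pairs (the sum of f is
    the sum of id * od, up to 2-cycles) shows that 2-cycles are at most as many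
    as nonadjacent pairs, while the minimum degree gives the converse; all the
    bounds are then attained, which is impossible for p >= 7.  A pair (z,x) at
    distance at least 3 forces p = 2n and V = Out[z] + In[x] with n vertices on
    each side.  An arc xz makes both sides complete.  Without it, x dominates
    Out(z) and In(x) dominates z, hence Out(z) is independent; but two vertices
    of Out(z) at distance at least 3 from the same vertex of In(x) are adjacent.
    The orders 5 and 6 are settled by an exhaustive search with pruning. *)

Notation out e x := [set y | e x y].
Notation inn e x := [set y | e y x].

Definition converse (T : Type) (e : rel T) : rel T := fun x y => e y x.

Definition dicycle3_free (T : Type) (e : rel T) :=
  forall x y z, e x y -> e y z -> e z x -> False.

Lemma converse_dicycle3_free (T : Type) (e : rel T) :
  dicycle3_free e -> dicycle3_free (converse e).
Proof. by move=> H x y z xy yz zx; apply: (H y x z). Qed.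

(** * Isomorphisms with bipartite and explicitly listed digraphs *)

Lemma part_bij (T : finType) (P : {set T}) (n m : nat) :
  #|P| = m -> #|~: P| = n ->
  exists2 f : T -> 'I_n + 'I_m, bijective f &
    forall x, (if f x is inr _ then true else false) = (x \in P).
Proof.
move=> Pm Pn.
have inC x : (x \in P) <> true -> x \in ~: P by rewrite inE => /negP.
(* Matching on [decP] keeps the membership proof that [enum_rank_in] needs. *)
pose f x : 'I_n + 'I_m := match decP (@idP (x \in P)) with
  | left h => inr (cast_ord Pm (enum_rank_in h x))
  | right h => inl (cast_ord Pn (enum_rank_in (inC x h) x))
  end.
have fP x : (if f x is inr _ then true else false) = (x \in P).
  by rewrite /f; case: decP => h; [rewrite h | apply/esym/negP].
exists f => //.
apply: inj_card_bij; last first.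
  by rewrite card_sum !card_ord -Pm -Pn addnC cardsC.
move=> x y; rewrite /f; case: decP => hx; case: decP => hy //;
  case=> /val_inj h; have := congr1 enum_val h;
  by rewrite !enum_rankK_in ?inC.
Qed.

Lemma diso_complete_bipartite (T : finType) (e : rel T) (P : {set T}) n m :
  #|P| = m -> #|~: P| = n -> (forall u v, e u v = ((u \in P) != (v \in P))) ->
  diso e (symdi (complete_bipartite n m)).
Proof.
move=> Pm Pn eP; have [f bf fP] := part_bij Pm Pn.
exists f => // x y; rewrite eP -!fP /symdi /=.
by case: (f x) => ?; case: (f y).
Qed.

Lemma sub_complete_bipartite (T : finType) (e : rel T) (P : {set T}) n m :
  #|P| = m -> #|~: P| = n -> (forall u v, e u v -> (u \in P) != (v \in P)) ->
  iso_spanning_sub e (symdi (complete_bipartite n m)).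
Proof.
move=> Pm Pn eP; have [f bf fP] := part_bij Pm Pn.
have [g gf fg] := bf.
exists (fun a b => e (g a) (g b)); last by exists f => // x y; rewrite !gf.
move=> a b /eP; rewrite -!fP !fg /symdi /=.
by case: a => ?; case: b.
Qed.

Lemma diso_lists (T T' : finType) (e : rel T) (e' : rel T')
    (x0 : T) (y0 : T') (s : seq T) (t : seq T') :
  uniq s -> uniq t -> size s = size t ->
  (forall x, x \in s) -> (forall y, y \in t) ->
  (forall i j, i < size s -> j < size s ->
     e (nth x0 s i) (nth x0 s j) = e' (nth y0 t i) (nth y0 t j)) ->
  diso e e'.
Proof.
move=> us ut st sT tT H.
have si x : index x s < size s by rewrite index_mem.
have ti y : index y t < size t by rewrite index_mem.
exists (fun x => nth y0 t (index x s)).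
  exists (fun y => nth x0 s (index y t)) => [x|y].
    by rewrite index_uniq ?nth_index // -st.
  by rewrite index_uniq ?nth_index // st.
by move=> x y /=; rewrite -H // !nth_index.
Qed.

(** * Digraphs without 3-cycles *)

Section OddNoTriangle.
Variables (T : finType) (n : nat).
Hypotheses (cardT : #|T| = 2 * n + 1) (n_gt1 : 1 < n).

(** For each arc [x y] the set [out e y] avoids [inn e x], whose complement [W] has at most [n]
    elements; so [out e y = W]. The parts turn out to be [inn e x] and [W]. *)
Lemma odd_big_indegree (e : rel T) (x : T) :
  irreflexive e -> dicycle3_free e ->
  (forall v, n <= outdeg e v) -> (forall v, n <= indeg e v) ->
  n < indeg e x ->
  exists2 P : {set T}, #|P| = n + 1 & forall u v, e u v = ((u \in P) != (v \in P)).
Proof.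
move=> eI no3 odn idn xbig.
pose W := ~: inn e x.
have cW : indeg e x + #|W| = 2 * n + 1 by rewrite -cardT cardsC.
have outW y : e x y -> out e y = W.
  move=> xy; apply/eqP; rewrite eqEcard; apply/andP; split.
    by apply/subsetP=> v; rewrite !inE => yv; apply/negP => /(no3 _ _ _ xy yv).
  by have := odn y; rewrite /outdeg; lia.
have eW y v : e x y -> e y v = ~~ e v x.
  by move=> /outW/setP/(_ v); rewrite !inE.
have [y0 xy0] : exists y, e x y.
  have /card_gt0P[y] : 0 < outdeg e x by have := odn x; lia.
  by rewrite inE => ?; exists y.
have idx : indeg e x = n.+1.
  by have := odn y0; rewrite /outdeg outW //; lia.
have YI y : e x y -> e y x.
  by move=> xy; have := eI y; rewrite eW // => /negbFE.
(* [out e x] contains at least [n] of the [n + 1] vertices of [inn e x], so at most one in-neighbour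
   of [x] is exceptional, that is, not joined to [x] by a 2-cycle. *)
have Z1 v z : e v x -> ~~ e x v -> e z x -> ~~ e x z -> v = z.
  move=> vx xv zx xz; have : #|inn e x :\: out e x| <= 1.
    rewrite cardsD; have -> : inn e x :&: out e x = out e x.
      by apply/setIidPr/subsetP => y; rewrite !inE => /YI.
    by have := odn x; move: idx; rewrite /indeg /outdeg; lia.
  by move/card_le1_eqP; apply; rewrite !inE ?xv ?xz.
(* A vertex [v] dominating [x] and [y] is the exceptional one; an in-neighbour [u] of [v] then gives
   a 3-cycle [y u v], an arc barred by [eW], or a loop. *)
have inW y v : e x y -> e v y -> ~~ e v x.
  move=> xy vy; apply/negP => vx.
  have xv : ~~ e x v by apply/negP => /eW ev; rewrite ev YI in vy.
  have /card_gt0P[u] : 0 < indeg e v by have := idn v; lia.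
  rewrite inE => uv.
  have [ux|ux] := boolP (e u x); last by apply: (no3 y u v) => //; rewrite eW.
  have [xu|xu] := boolP (e x u); first by rewrite eW // vx in uv.
  by rewrite (Z1 u v) // eI in uv.
have inE' y v : e x y -> e v y = ~~ e v x.
  move=> xy; have /setP/(_ v) : inn e y = W.
    apply/eqP; rewrite eqEcard; apply/andP; split.
      by apply/subsetP=> u; rewrite !inE => /inW; apply.
    by have := idn y; rewrite /indeg; lia.
  by rewrite !inE.
have WW u v : ~~ e u x -> ~~ e v x -> e u v = false.
  move=> ux vx; apply/negP => uv.
  by apply: (no3 y0 u v) => //; [rewrite eW | rewrite inE'].
have YE y : e x y = e y x.
  apply/idP/idP => [/YI//|yx]; apply/negP => /negP xy.
  have /setP/(_ x) : inn e y = W.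
    apply/eqP; rewrite eqEcard; apply/andP; split.
      apply/subsetP=> u; rewrite !inE => uy; apply/negP => ux.
      have [xu|xu] := boolP (e x u); first by rewrite eW // yx in uy.
      by rewrite (Z1 u y) // eI in uy.
    by have := idn y; rewrite /indeg; lia.
  by rewrite !inE eI (negbTE xy).
exists (inn e x); first by move: idx; rewrite /indeg; lia.
move=> u v; rewrite !inE.
have [ux|ux] := boolP (e u x); first by rewrite eW; [case: (e v x) | rewrite YE].
have [vx|vx] := boolP (e v x); first by rewrite inE' 1?YE.
by rewrite WW.
Qed.

Variables (e : rel T).
Hypotheses (eI : irreflexive e) (no3 : dicycle3_free e).
Hypotheses (od_n : forall v, outdeg e v = n) (id_n : forall v, indeg e v = n).

(** If the arc [x y] had no reverse, [out e y] would fill the complement of [inn e x] minus [y],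
    which has size [n]; but that set contains [x]. *)
Lemma odd_regular_symmetric : symmetric e.
Proof.
suff H x y : e x y -> e y x by move=> x y; apply/idP/idP; apply: H.
move=> xy; apply/negPn/negP => yx.
have /setP/(_ x) : out e y = (~: inn e x) :\ y.
  apply/eqP; rewrite eqEcard; apply/andP; split.
    apply/subsetP=> v; rewrite !inE => yv; apply/andP; split.
      by apply: contraTneq yv => ->; rewrite eI.
    by apply/negP => /(no3 xy yv).
  have := cardsD1 y (~: inn e x); rewrite !inE yx /=.
  have := cardsC (inn e x); have := od_n y; have := id_n x.
  by rewrite /outdeg /indeg; lia.
rewrite !inE eI (negbTE yx) /= andbT.
by have -> : x != y by apply: contraTneq xy => ->; rewrite eI.
Qed.

(** The ends of an edge [x y] have disjoint neighbourhoods covering all but one vertex [z]. Each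
    meets the neighbourhood of [z] in at most one vertex, so [n = 2], and the 5-cycle is
    [a x y b z]. *)
Lemma odd_regular_C5 : diso e (symdi (cycle_graph 5)).
Proof.
have sym := odd_regular_symmetric.
have tri x y z : e x y -> e y z -> e x z -> False.
  by move=> xy yz; rewrite sym; apply: no3 xy yz.
have /card_gt0P[x _] : 0 < #|T| by lia.
have /card_gt0P[y] : 0 < outdeg e x by rewrite od_n; lia.
rewrite inE => xy.
have Oxy v : v \in out e x -> v \in out e y -> False.
  by rewrite !inE => xv yv; apply: (tri x y v).
have [z] : exists z, z \notin out e x :|: out e y.
  apply/existsP; rewrite -negb_forall; apply/negP => /forallP all_in.
  have [+ _] := leq_card_setU (out e x) (out e y).
  have -> : out e x :|: out e y = [set: T].
    by apply/setP => v; rewrite all_in inE.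
  by have := od_n x; have := od_n y; rewrite /outdeg cardsT; lia.
rewrite !inE negb_or => /andP[xz yz].
have cover v : v != z -> e x v || e y v.
  move=> vz; apply/negPn/negP => nv.
  have := cardsU (out e x) (out e y); have -> : out e x :&: out e y = set0.
    by apply/setP => u; rewrite !inE; apply/negP => /andP[xu yu];
       apply: (Oxy u); rewrite inE.
  have : #|out e x :|: out e y| <= #|~: [set z; v]|.
    apply/subset_leq_card/subsetP => u; rewrite !inE => h.
    by apply: contraL h => /orP[] /eqP->; rewrite ?(negbTE xz) ?(negbTE yz).
  have := cardsC [set z; v]; rewrite cards2 eq_sym vz cards0.
  by have := od_n x; have := od_n y; rewrite /outdeg; lia.
have ne u v : e u v -> u != v by apply: contraTneq => ->; rewrite eI.
(* The neighbours of a lie in z |: out y' but not in out z. *)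
have few x' y' a : e x' y' -> e x' a -> e z a -> ~~ e x' z -> ~~ e y' z ->
    (forall v, v != z -> e x' v || e y' v) ->
    #|out e z :&: out e y'| <= 1.
  move=> xy' xa za xz' yz' cov.
  have sub : out e a :\ z \subset out e y' :\: out e z.
    apply/subsetP => v; rewrite !inE => /andP[vz av].
    have -> /= : ~~ e z v by apply/negP => /(tri z a v za av).
    by have /orP[xv|//] := cov _ vz; case: (tri x' a v).
  have := subset_leq_card sub; have := cardsD1 z (out e a).
  have := cardsID (out e z) (out e y').
  rewrite inE (sym a) za setIC; have := od_n a; have := od_n y'.
  by rewrite /outdeg; lia.
have Oz v : e z v -> e x v || e y v.
  by move=> zv; apply: cover; rewrite eq_sym ne.
(* Otherwise [out e z] would lie in [out e y'] minus [x'], which has only [n - 1] vertices. *)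
have side x' y' : e x' y' -> ~~ e x' z -> ~~ e y' z ->
    (forall v, v != z -> e x' v || e y' v) -> exists2 a, e x' a & e z a.
  move=> xy' xz' yz' cov; apply/exists_inP; apply: contraT => /exists_inPn nv; exfalso.
  have : out e z \subset out e y' :\ x'.
    apply/subsetP => v; rewrite !inE => zv.
    rewrite (contraTneq _ zv) ?(contraNneq _ xz') //=; last first.
      by move=> vx; rewrite vx sym (negbTE xz') in zv.
    have /orP[xv|//] : e x' v || e y' v by rewrite cov // eq_sym ne.
    by have /negP := nv v xv.
  move/subset_leq_card; have := cardsD1 x' (out e y').
  by rewrite inE sym xy'; have := od_n z; have := od_n y'; rewrite /outdeg; lia.
have cover' v : v != z -> e y v || e x v by rewrite orbC; apply: cover.
have yx : e y x by rewrite sym.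
have [a xa za] := side x y xy xz yz cover.
have [b yb zb] := side y x yx yz xz cover'.
have n2 : n = 2.
  have h1 := few x y a xy xa za xz yz cover.
  have h2 := few y x b yx yb zb yz xz cover'.
  have : out e z = (out e z :&: out e x) :|: (out e z :&: out e y).
    apply/setP => v; rewrite !inE -andb_orr; apply/idP/andP => [zv|[]//].
    by split=> //; apply: Oz.
  have [+ _] := leq_card_setU (out e z :&: out e x) (out e z :&: out e y).
  move=> + E; rewrite -E; have := od_n z; rewrite /outdeg; lia.
have nbr u v w : e u v -> e u w -> v != w -> forall t, e u t = (t == v) || (t == w).
  move=> uv uw vw t; have /setP/(_ t) : out e u = [set v; w].
    apply/eqP; rewrite eq_sym eqEcard; apply/andP; split.
      by apply/subsetP => r; rewrite !inE => /orP[] /eqP->.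
    by rewrite cards2 vw; have := od_n u; rewrite /outdeg n2 => ->.
  by rewrite !inE.
have neq u v w : e u v -> ~~ e u w -> v != w.
  by move=> uv; apply: contraNneq => <-.
have xb : ~~ e x b by apply/negP => /(tri x y b xy yb).
have ya : ~~ e y a by apply/negP => /(tri x y a xy); apply.
have ab : a != b by apply: neq xa xb.
have us : uniq [:: a; x; y; b; z].
  rewrite /= !inE !negb_or -!andbA ab (neq _ _ _ xy xb) (neq _ _ _ xy xz).
  rewrite (neq _ _ _ xa xz) (neq _ _ _ yb yz) !andbT /=.
  have zx : ~~ e z x by rewrite sym.
  have zy : ~~ e z y by rewrite sym.
  by rewrite (eq_sym a x) (ne x a xa) (neq z a y za zy) (ne x y xy) (eq_sym x b)
             (neq z b x zb zx) (neq y x z yx yz).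
pose s := [:: a; x; y; b; z].
pose t : seq 'I_5 := [:: @Ordinal 5 0 isT; @Ordinal 5 1 isT; @Ordinal 5 2 isT;
                         @Ordinal 5 3 isT; @Ordinal 5 4 isT].
have row i k l j : i < 5 -> k < 5 -> l < 5 -> j < 5 -> k != l ->
    e (nth a s i) (nth a s k) -> e (nth a s i) (nth a s l) ->
    e (nth a s i) (nth a s j) = (j == k) || (j == l).
  move=> ? ? ? ? kl ek el.
  by rewrite (nbr _ _ _ ek el) ?nth_uniq //.
apply: (@diso_lists _ _ _ _ a ord0 s t) => //.
- move=> v; suff: s =i predT by move/(_ v) => ->.
  apply/subset_cardP; last exact: subset_predT.
  by rewrite cardT n2; apply/card_uniqP.
- by move=> [[|[|[|[|[|?]]]]] ?].
move=> i j.
case: i => [|[|[|[|[|//]]]]] _ jlt; rewrite /s.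
- rewrite (row 0 1 4) //= 1?sym //.
  by move: j jlt => [|[|[|[|[|//]]]]] _.
- rewrite (row 1 0 2) //=.
  by move: j jlt => [|[|[|[|[|//]]]]] _.
- rewrite (row 2 1 3) //=.
  by move: j jlt => [|[|[|[|[|//]]]]] _.
- rewrite (row 3 2 4) //= 1?sym //.
  by move: j jlt => [|[|[|[|[|//]]]]] _.
- rewrite (row 4 0 3) //=.
  by move: j jlt => [|[|[|[|[|//]]]]] _.
Qed.
End OddNoTriangle.

(** * Even order without 3-cycles *)

Section EvenNoTriangle.
Variables (T : finType) (n : nat).
Hypotheses (cardT : #|T| = 2 * n) (n_gt2 : 2 < n).

(** If it exceeds [n], an out-neighbour [y] of [x] has out-neighbourhood [W] of size [n - 1], hence
    in-degree at least [n], so some [z] dominates both [x] and [y]. All in-neighbours of [z] lie in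
    [inn e x] but not in [out e x], which leaves at most one besides [z]. *)
Lemma even_indegree_le (e : rel T) (x : T) :
  irreflexive e -> dicycle3_free e ->
  (forall v, n <= (outdeg e v).+1) -> (forall v, n <= (indeg e v).+1) ->
  (forall v, 2 * n <= (deg e v).+1) -> indeg e x <= n.
Proof.
move=> eI no3 odn idn degn; rewrite leqNgt; apply/negP => xbig.
pose W := ~: inn e x.
have cW : indeg e x + #|W| = 2 * n by rewrite -cardT cardsC.
have outW y : e x y -> out e y = W.
  move=> xy; apply/eqP; rewrite eqEcard; apply/andP; split.
    by apply/subsetP=> v; rewrite !inE => yv; apply/negP => /(no3 _ _ _ xy yv).
  by have := odn y; rewrite /outdeg; lia.
have eW y v : e x y -> e y v = ~~ e v x.
  by move=> /outW/setP/(_ v); rewrite !inE.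
have [y xy] : exists y, e x y.
  have /card_gt0P[y] : 0 < outdeg e x by have := odn x; lia.
  by rewrite inE => ?; exists y.
have ody : outdeg e y = n.-1.
  by have := odn y; rewrite /outdeg outW //; lia.
have YI u : e x u -> e u x.
  by move=> xu; have := eI u; rewrite eW // => /negbFE.
have [z zx zy] : exists2 z, e z x & e z y.
  apply/exists_inP; apply: contraT => /exists_inPn nv; exfalso.
  have : inn e y \subset W.
    by apply/subsetP => v; rewrite !inE; apply: contraTN => /nv.
  move/subset_leq_card; have := degn y; rewrite /deg ody /indeg.
  by move: cW xbig; rewrite /indeg; lia.
have xz : ~~ e x z by apply/negP => /eW ez; rewrite ez YI in zy.
have : inn e z \subset (inn e x :\: out e x) :\ z.
  apply/subsetP => v; rewrite !inE => vz.
  have -> /= : v != z by apply: contraTneq vz => ->; rewrite eI.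
  apply/andP; split; first by apply/negP => /eW ev; rewrite ev zx in vz.
  apply/negPn/negP => vx; apply: (no3 y v z) => //.
  by rewrite eW.
move/subset_leq_card; have := cardsD1 z (inn e x :\: out e x).
rewrite !inE zx xz cardsD; have -> : inn e x :&: out e x = out e x.
  by apply/setIidPr/subsetP => u; rewrite !inE => /YI.
have := odn x; have := idn z; have := odn y; move: cW.
rewrite /indeg /outdeg (outW y) //.
lia.
Qed.

Lemma even_full_in (e : rel T) (x y : T) :
  irreflexive e -> dicycle3_free e -> (forall v, n <= (outdeg e v).+1) ->
  indeg e x = n -> e x y -> e y x.
Proof.
move=> eI no3 odn idx xy; apply/negPn/negP => yx.
have /setP/(_ x) : out e y = (~: inn e x) :\ y.
  apply/eqP; rewrite eqEcard; apply/andP; split.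
    apply/subsetP=> v; rewrite !inE => yv; apply/andP; split.
      by apply: contraTneq yv => ->; rewrite eI.
    by apply/negP => /(no3 _ _ _ xy yv).
  have := cardsD1 y (~: inn e x); rewrite !inE yx /=.
  have := cardsC (inn e x); have := odn y; move: idx.
  by rewrite /outdeg /indeg; lia.
rewrite !inE eI (negbTE yx) /= andbT.
by have -> : x != y by apply: contraTneq xy => ->; rewrite eI.
Qed.

Variables (e : rel T).
Hypotheses (eI : irreflexive e) (no3 : dicycle3_free e).
Hypotheses (odn : forall v, n <= (outdeg e v).+1).
Hypotheses (idn : forall v, n <= (indeg e v).+1).
Hypotheses (degn : forall v, 2 * n <= (deg e v).+1).

Lemma even_no_triangle_bipartite :
  iso_spanning_sub e (symdi (complete_bipartite n n)).
Proof.
have id_le v : indeg e v <= n by apply: even_indegree_le.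
have od_le v : outdeg e v <= n.
  apply: (@even_indegree_le (converse e)) => // [|u].
    exact: converse_dicycle3_free.
  by have := degn u; rewrite /deg addnC.
pose g x y := e x y || e y x.
have gs x y : g x y = g y x by rewrite /g orbC.
(* All semi-degrees are [n - 1] or [n], and each vertex attains [n] at least once; by [even_full_in]
   one of its two neighbourhoods then contains the other. *)
have [nest cg] : (forall x, ((forall y, e x y -> e y x) \/ (forall y, e y x -> e x y)))
    /\ forall x, #|out g x| = n.
  suff H x : ((forall y, e x y -> e y x) \/ (forall y, e y x -> e x y)) /\ #|out g x| = n.
    by split=> x; case: (H x).
  have [idx|idx] := eqVneq (indeg e x) n.
    have h y := @even_full_in e x y eI no3 odn idx.
    split; first by left.
    rewrite -idx; apply: eq_card => y; rewrite !inE /g.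
    by case: (boolP (e x y)) => // /h ->.
  have odx : outdeg e x = n.
    by have := degn x; have := id_le x; have := od_le x; rewrite /deg; lia.
  have h y : e y x -> e x y :=
    @even_full_in (converse e) x y eI (converse_dicycle3_free no3) idn odx.
  split; first by right.
  rewrite -odx; apply: eq_card => y; rewrite !inE /g.
  by case: (boolP (e y x)) => [/h ->//|_]; rewrite orbF.
have two x : #|out g x :\: (out e x :&: inn e x)| <= 1.
  rewrite cardsD; have -> : out g x :&: (out e x :&: inn e x) = out e x :&: inn e x.
    by apply/setP => v; rewrite !inE /g; case: (e x v); case: (e v x).
  rewrite cg; have [h|h] := nest x.
    have -> : out e x :&: inn e x = out e x.
      by apply/setP => v; rewrite !inE; case: (boolP (e x v)) => // /h ->.
    by have := odn x; rewrite /outdeg; lia.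
  have -> : out e x :&: inn e x = inn e x.
    by apply/setP => v; rewrite !inE andbC; case: (boolP (e v x)) => // /h ->.
  by have := idn x; rewrite /indeg; lia.
have one x u v : e x u -> ~~ e u x -> g x v -> v != u -> e x v && e v x.
  move=> xu ux xv vu; apply/negPn/negP => h; move: vu.
  have /card_le1_eqP H := two x; rewrite (H v u) ?eqxx //.
    by rewrite !inE xv andbT.
  by rewrite !inE /g xu (negbTE ux).
have one' x u v : e u x -> ~~ e x u -> g x v -> v != u -> e x v && e v x.
  move=> xu ux xv vu; apply/negPn/negP => h; move: vu.
  have /card_le1_eqP H := two x; rewrite (H v u) ?eqxx //.
    by rewrite !inE xv andbT.
  by rewrite !inE /g xu (negbTE ux).
have ne u v : g u v -> u != v by apply: contraTneq => ->; rewrite /g eI.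
(* Each vertex has at most one neighbour without a 2-cycle, so the one-way arc [x y] forces 2-cycles
   on the other two sides, and the triangle can be oriented. *)
have tri1 x y z : e x y -> ~~ e y x -> g y z -> g z x -> False.
  move=> xy yx yz zx.
  have /andP[xz _] : e z x && e x z.
    by rewrite andbC (one x y) //; [rewrite gs | rewrite eq_sym ne].
  have /andP[h _] : e y z && e z y by rewrite (one' y x) // ne.
  exact: (no3 xy h xz).
have tri x y z : g x y -> g y z -> g z x -> False.
  move=> xy yz zx.
  have [xy1|xy1] := boolP (e x y); last first.
    move: xy; rewrite /g (negbTE xy1) /= => yx.
    by apply: (tri1 y x z) => //; rewrite gs.
  have [yx1|yx1] := boolP (e y x); last exact: (tri1 x y z).
  have [yz1|yz1] := boolP (e y z); last first.
    move: yz; rewrite /g (negbTE yz1) /= => zy.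
    by apply: (tri1 z y x) => //; rewrite gs.
  have [zx1|zx1] := boolP (e z x); first exact: (no3 xy1 yz1 zx1).
  move: zx; rewrite /g (negbTE zx1) /= => xz.
  by apply: (tri1 x z y) => //; rewrite gs.
have /card_gt0P[x _] : 0 < #|T| by lia.
have /card_gt0P[y] : 0 < #|out g x| by rewrite cg; lia.
rewrite inE => xy.
have Ny : out g y = ~: out g x.
  apply/eqP; rewrite eqEcard; apply/andP; split.
    apply/subsetP => v; rewrite !inE => yv; apply/negP => xv.
    by apply: (tri x y v) => //; rewrite gs.
  by have := cardsC (out g x); rewrite !cg; lia.
apply: (@sub_complete_bipartite _ _ (out g x)); rewrite -?Ny ?cg //.
move=> u v uv; have guv : g u v by rewrite /g uv.
rewrite !inE; have [xu|xu] := boolP (g x u); have [xv|xv] := boolP (g x v) => //.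
  by case: (tri x u v) => //; rewrite gs.
have yE w : g y w = ~~ g x w by move/setP: Ny => /(_ w); rewrite !inE.
by case: (tri y u v) => //; [rewrite yE | rewrite gs yE].
Qed.

End EvenNoTriangle.

(** * 4-cycles and counting paths of length 2 *)

(* Opposite vertices being distinct suffices: the relation is irreflexive. *)
Definition dicycle4_free (T : eqType) (e : rel T) :=
  forall a b c d, e a b -> e b c -> e c d -> e d a -> a != c -> b != d -> False.

Lemma converse_dicycle4_free (T : eqType) (e : rel T) :
  dicycle4_free e -> dicycle4_free (converse e).
Proof.
move=> H a b c d ab bc cd da ac bd.
by apply: (H a d c b) => //; rewrite eq_sym.
Qed.

Lemma sum_eq_pointwise (I : finType) (F G : I -> nat) :
  (forall i, F i <= G i) -> \sum_i G i <= \sum_i F i -> forall i, F i = G i.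
Proof.
move=> FG S i; apply/eqP; rewrite eqn_leq FG /=.
rewrite (bigD1 i) //= [X in _ <= X](bigD1 i) //= in S.
have : \sum_(j | j != i) F j <= \sum_(j | j != i) G j by apply: leq_sum.
lia.
Qed.

Lemma card_sum_bool (T : finType) (P : pred T) : #|[set y | P y]| = \sum_y P y.
Proof. by rewrite -sum1dep_card big_mkcond; apply: eq_bigr => y _; case: (P y). Qed.

Section NoFarPair.
Variables (T : finType) (e : rel T) (s : nat).
Hypotheses (eI : irreflexive e) (no4 : dicycle4_free e) (s_gt2 : 2 < s).
Hypotheses (ods : forall v, s <= outdeg e v) (ids : forall v, s <= indeg e v).
Hypothesis degp : forall v, #|T| <= (deg e v).+1.
Hypothesis no_far :
  forall z x, z != x -> ~~ e z x -> exists2 v, e z v & e v x.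

Definition npath2 (x z : T) := #|out e x :&: inn e z|.

(** Paths from [x] to [z] and from [z] to [x] with distinct middle vertices form a 4-cycle, so all
    these middle vertices coincide. *)
Lemma npath2_opposite x z : x != z ->
  npath2 x z = 0 \/ npath2 z x = 0 \/ npath2 x z = 1 /\ npath2 z x = 1.
Proof.
move=> xz.
have [/eqP|/card_gt0P[y]] := posnP (npath2 x z); first by left; apply/eqP.
rewrite !inE => /andP[xy yz].
have [/eqP|/card_gt0P[w]] := posnP (npath2 z x); first by right; left; apply/eqP.
rewrite !inE => /andP[zw wx]; right; right.
have H u v : e x u -> e u z -> e z v -> e v x -> u = v.
  move=> xu uz zv vx; apply/eqP/negPn/negP => uv.
  exact: (no4 xu uz zv vx xz uv).
split; apply/eqP/cards1P.
  exists w; apply/setP => u; rewrite !inE; apply/andP/eqP => [[xu uz]|->].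
    exact: H.
  by rewrite -(H y w).
exists y; apply/setP => u; rewrite !inE; apply/andP/eqP => [[zu ux]|->].
  by rewrite (H y u).
by rewrite (H y w).
Qed.

Lemma npath2_gt0 z x : z != x -> ~~ e z x -> 0 < npath2 z x.
Proof.
move=> zx nzx; have [v zv vx] := no_far zx nzx.
by apply/card_gt0P; exists v; rewrite !inE zv.
Qed.

Lemma npath2_le_out x z : npath2 x z <= outdeg e x.
Proof. exact/subset_leq_card/subsetIl. Qed.

Lemma npath2_le_in x z : npath2 x z <= indeg e z.
Proof. exact/subset_leq_card/subsetIr. Qed.

Lemma npath2_lt x z : e x z -> npath2 x z < outdeg e x /\ npath2 x z < indeg e z.
Proof.
move=> xz; split; apply: proper_card; rewrite properE ?subsetIl ?subsetIr /=.
  by apply/subsetPn; exists z; rewrite !inE ?eI ?andbF.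
by apply/subsetPn; exists x; rewrite !inE ?eI.
Qed.

Definition twocycle x z := e x z && e z x.
Definition nonadj x z := [&& x != z, ~~ e x z & ~~ e z x].

(** The two sides of the bound for an ordered pair, scaled so that the sums of [indeg * outdeg]
    cancel. The weight [2 * s + 2] is slack that every 2-cycle leaves when [2 < s]; the last term of
    [pair_rhs] pays for the closed paths on the diagonal. *)
Definition pair_lhs (q : T * T) :=
  2 * (npath2 q.1 q.2 + npath2 q.2 q.1) + (2 * s + 2) * twocycle q.1 q.2.
Definition pair_rhs (q : T * T) :=
  e q.1 q.2 * (outdeg e q.2 + indeg e q.1)
  + e q.2 q.1 * (outdeg e q.1 + indeg e q.2)
  + 4 * nonadj q.1 q.2 + 4 * ((q.1 == q.2) * npath2 q.1 q.1).

Lemma pair_bound q : pair_lhs q <= pair_rhs q.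
Proof.
case: q => x z; rewrite /pair_lhs /pair_rhs /twocycle /nonadj /=.
have [<-|xz] := eqVneq x z; first by rewrite eI /=; lia.
have zx : z != x by rewrite eq_sym.
have := npath2_opposite xz; have := npath2_le_out x z; have := npath2_le_in x z.
have := npath2_le_out z x; have := npath2_le_in z x.
have := ods x; have := ods z; have := ids x; have := ids z.
have [exz|exz] := boolP (e x z); have [ezx|ezx] := boolP (e z x) => /=.
(* With one path each way the bound needs [2 * s + 6 <= 4 * s], hence [2 < s]. *)
- by have := npath2_lt exz; have := npath2_lt ezx; lia.
- by have := npath2_gt0 zx ezx; lia.
- by have := npath2_gt0 xz exz; lia.
- by have := npath2_gt0 zx ezx; have := npath2_gt0 xz exz; lia.
Qed.

Lemma outdeg_sum x : outdeg e x = \sum_y e x y.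
Proof. exact: card_sum_bool. Qed.

Lemma indeg_sum x : indeg e x = \sum_y e y x.
Proof. exact: card_sum_bool. Qed.

Lemma npath2_sum x z : npath2 x z = \sum_v e x v * e v z.
Proof.
rewrite /npath2; have -> : out e x :&: inn e z = [set v | e x v && e v z].
  by apply/setP => v; rewrite !inE.
by rewrite card_sum_bool; apply: eq_bigr => v _; rewrite mulnb.
Qed.

Let S := \sum_v indeg e v * outdeg e v.
Let c := \sum_(q : T * T) twocycle q.1 q.2.
Let a := \sum_(q : T * T) nonadj q.1 q.2.

Lemma sum_swap (F : T -> T -> nat) :
  \sum_(q : T * T) F q.2 q.1 = \sum_(q : T * T) F q.1 q.2.
Proof.
by rewrite -(pair_bigA _ (fun x z => F z x)) -(pair_bigA _ F) /= exchange_big.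
Qed.

(** Double counting by the middle vertex. *)
Lemma sum_npath2 : \sum_(q : T * T) npath2 q.1 q.2 = S.
Proof.
rewrite -(pair_bigA _ npath2) /=.
under eq_bigr => x _ do under eq_bigr => z _ do rewrite npath2_sum.
under eq_bigr => x _ do rewrite exchange_big.
rewrite exchange_big; apply: eq_bigr => v _ /=.
rewrite indeg_sum outdeg_sum big_distrl /=; apply: eq_bigr => x _.
by rewrite big_distrr.
Qed.

(** Grouping the first summand by the head of the arc and the second by its tail gives [S] each
    time. *)
Lemma sum_arcs :
  \sum_(q : T * T) e q.1 q.2 * (outdeg e q.2 + indeg e q.1) = 2 * S.
Proof.
rewrite -(pair_bigA _ (fun x z => e x z * (outdeg e z + indeg e x))) /=.
under eq_bigr => x _ do
  (under eq_bigr => z _ do rewrite mulnDr; rewrite big_split /=).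
rewrite big_split /= mul2n -addnn; congr (_ + _).
  rewrite exchange_big; apply: eq_bigr => v _ /=.
  by rewrite indeg_sum big_distrl.
apply: eq_bigr => v _; rewrite outdeg_sum big_distrr /=.
by apply: eq_bigr => z _; rewrite mulnC.
Qed.

Lemma sum_diagonal : \sum_(q : T * T) (q.1 == q.2) * npath2 q.1 q.1 = c.
Proof.
rewrite -(pair_bigA _ (fun x z => (x == z) * npath2 x x)) /=.
rewrite /c -(pair_bigA _ (fun x z => nat_of_bool (twocycle x z))) /=.
apply: eq_bigr => x _; rewrite (bigD1 x) //= eqxx big1 ?mul1n ?addn0.
  by rewrite npath2_sum; apply: eq_bigr => z _; rewrite mulnb.
by move=> z; rewrite eq_sym => /negbTE ->.
Qed.

Lemma sum_pair_lhs : \sum_q pair_lhs q = 4 * S + (2 * s + 2) * c.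
Proof.
rewrite /pair_lhs big_split /= -!big_distrr /= -/c big_split /=.
by rewrite (sum_swap npath2) sum_npath2; lia.
Qed.

Lemma sum_pair_rhs : \sum_q pair_rhs q = 4 * S + 4 * a + 4 * c.
Proof.
rewrite /pair_rhs !big_split /= sum_arcs.
rewrite (sum_swap (fun x z => e x z * (outdeg e z + indeg e x))) sum_arcs.
by rewrite sum_diagonal -/a big1_eq; lia.
Qed.

(** For distinct [x] and [z], [e x z + e z x] is 1, except for 2 at a 2-cycle and 0 at a nonadjacent
    pair; the minimum degree bounds the total from below. *)
Lemma nonadj_le : a <= c.
Proof.
have H : \sum_v deg e v + a = #|T| * #|T|.-1 + c.
  have -> : #|T| * #|T|.-1 = \sum_(q : T * T) (q.1 != q.2).
    rewrite -(pair_bigA _ (fun x z => nat_of_bool (x != z))) /=.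
    rewrite -sum_nat_const; apply: eq_bigr => x _.
    rewrite -card_sum_bool -(cardsC1 x).
    by apply: eq_card => z; rewrite !inE eq_sym.
  have -> : \sum_v deg e v = \sum_(q : T * T) (e q.1 q.2 + e q.2 q.1).
    rewrite -(pair_bigA _ (fun x z => e x z + e z x)) /=.
    by apply: eq_bigr => x _; rewrite /deg outdeg_sum indeg_sum big_split.
  rewrite -!big_split; apply: eq_bigr => -[x z] _ /=.
  rewrite /nonadj /twocycle; have [<-|] := eqVneq x z; first by rewrite eI.
  by case: (e x z); case: (e z x).
have : #|T| * #|T|.-1 <= \sum_v deg e v.
  by rewrite -sum_nat_const; apply: leq_sum => v _; have := degp v; lia.
lia.
Qed.

(** Summing the bounds gives [(2 * s - 2) * c <= 4 * a]; since [a <= c] and [2 < s], nothing is lost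
    in the sum, hence nothing at any pair. *)
Lemma pair_tight q : pair_lhs q = pair_rhs q.
Proof.
apply: sum_eq_pointwise pair_bound _ q.
rewrite sum_pair_lhs sum_pair_rhs; have := nonadj_le.
have : 8 * c <= (2 * s + 2) * c by rewrite leq_mul2r; apply/orP; right; lia.
lia.
Qed.

(** Tightness gives [out e z = inn e x]. This set is independent, and two of its vertices together
    miss the minimum degree. *)
Lemma one_way_arc_false x z : e x z -> ~~ e z x -> False.
Proof.
move=> xz nzx.
have ne u v : e u v -> u != v by apply: contraTneq => ->; rewrite eI.
have xzn : x != z := ne _ _ xz.
have zxn : z != x by rewrite eq_sym.
have Rx : out e z = inn e x.
  have := pair_tight (x, z).
  rewrite /pair_lhs /pair_rhs /twocycle /nonadj /= xz (negbTE nzx) (negbTE xzn) /=.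
  have := npath2_opposite xzn; have := npath2_le_out z x.
  have := npath2_le_in z x; have := npath2_gt0 zxn nzx; have := ods z; have := ids x.
  move=> h1 h2 h3 h4 h5 h6 h7.
  have [E1 E2] : npath2 z x = outdeg e z /\ npath2 z x = indeg e x by lia.
  have S1 : out e z :&: inn e x == out e z.
    by rewrite eqEcard subsetIl /=; apply/eq_leq/esym.
  have S2 : out e z :&: inn e x == inn e x.
    by rewrite eqEcard subsetIr /=; apply/eq_leq/esym.
  by rewrite -(eqP S1) -{2}(eqP S2).
have RE v : e z v = e v x by move/setP: Rx => /(_ v); rewrite !inE.
have indep r r' : e z r -> e z r' -> ~~ e r r'.
  move=> zr zr'; apply/negP => rr'.
  by apply: (no4 xz zr rr'); [rewrite -RE | rewrite eq_sym ne // -RE | rewrite ne].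
have [r [r' [zr zr' rr']]] : exists r r', [/\ e z r, e z r' & r != r'].
  have /card_gt1P[r [r' [h1 h2 h3]]] : 1 < #|out e z|.
    by have := ods z; rewrite /outdeg; lia.
  by exists r, r'; move: h1 h2; rewrite !inE.
(* [out e u] and [inn e v] avoid the at least [s] vertices of [out e z] and share at most one
   vertex, so their sizes add up to at most [#|T| - s + 1]. *)
have bound u v : e z u -> e z v -> u != v -> outdeg e u + indeg e v <= #|T| - 2.
  move=> zu zv uv.
  have vu : v != u by rewrite eq_sym.
  have uv1 : npath2 u v <= 1.
    have := npath2_opposite uv; have := npath2_gt0 vu (indep _ _ zv zu); lia.
  have sub : out e u :|: inn e v \subset ~: out e z.
    apply/subsetP => w; rewrite !inE; apply: contraTN => zw.
    by rewrite negb_or !indep.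
  have := subset_leq_card sub; have := cardsUI (out e u) (inn e v).
  have := cardsC (out e z); have := ods z; move: uv1.
  rewrite /npath2 /outdeg /indeg; lia.
have := bound _ _ zr zr' rr'; rewrite eq_sym in rr'; have := bound _ _ zr' zr rr'.
have := degp r; have := degp r'; rewrite /deg.
have : 1 < #|T| by have := ods x; have := max_card (out e x); rewrite /outdeg; lia.
lia.
Qed.

(** All arcs now lie in 2-cycles, and tightness makes the graph 3-regular with each edge in exactly
    one triangle. The triangles at [x] would pair off its three neighbours. *)
Lemma no_far_pair_false : 0 < #|T| -> False.
Proof.
case/card_gt0P => x _.
have sym u v : e u v -> e v u.
  by move=> uv; apply: contraT => /(one_way_arc_false uv).
have ne u v : e u v -> u != v by apply: contraTneq => ->; rewrite eI.
have symE u v : e u v = e v u by apply/idP/idP; apply: sym.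
have oi v : indeg e v = outdeg e v by apply: eq_card => u; rewrite !inE symE.
have fs u v : npath2 u v = npath2 v u.
  by apply: eq_card => w; rewrite !inE symE andbC (symE w).
have reg u v : e u v -> outdeg e u = 3 /\ npath2 u v = 1.
  move=> uv; have := pair_tight (u, v).
  rewrite /pair_lhs /pair_rhs /twocycle /nonadj /= uv (sym _ _ uv) (negbTE (ne _ _ uv)).
  have := npath2_opposite (ne _ _ uv); have := ods u; have := ods v.
  by rewrite (fs v u) !oi /=; lia.
have /card_gt0P[y] : 0 < outdeg e x by have := ods x; lia.
rewrite inE => xy; have [odx _] := reg _ _ xy.
have third u v : e x u -> e x v -> e u v -> forall w, e x w -> w != v -> e w u -> False.
  move=> xu xv uv w xw wv wu; have [_ f1] := reg _ _ xu.
  have : 1 < npath2 x u.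
    apply/card_gt1P; exists v, w; split; rewrite ?inE ?xv ?xw //=; first exact: sym.
    by rewrite eq_sym.
  by rewrite f1.
have partner u : e x u -> exists v, e x v /\ e u v.
  move=> xu; have [_ f1] := reg _ _ xu.
  have /card_gt0P[v] : 0 < npath2 x u by rewrite f1.
  by rewrite !inE => /andP[xv vu]; exists v; split=> //; apply: sym.
have [y' [xy' yy']] := partner _ xy.
have [y'' xy'' /andP[n1 n2]] : exists2 y'', e x y'' & (y'' != y) && (y'' != y').
  apply/exists_inP; apply: contraT => /exists_inPn H; exfalso.
  have : out e x \subset [set y; y'].
    apply/subsetP => v; rewrite !inE => /H; rewrite negb_and !negbK //.
  by move/subset_leq_card; rewrite cards2; move: odx; rewrite /outdeg; lia.
have [t [xt y''t]] := partner _ xy''.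
have [ty|ty] := eqVneq t y.
  by apply: (third y y' xy xy' yy' y''); rewrite -?ty.
have [ty'|ty'] := eqVneq t y'.
  apply: (third y' y xy' xy (sym _ _ yy') y'') => //; by rewrite -ty'.
have : uniq [:: y; y'; y''; t].
  rewrite /= !inE !negb_or (ne _ _ yy') (ne _ _ y''t) !(eq_sym _ t) ty ty'.
  by rewrite !(eq_sym _ y'') n1 n2.
move/(@uniq_leq_size _ _ (enum (out e x))) => H.
have /H : {subset [:: y; y'; y''; t] <= enum (out e x)}.
  by move=> v; rewrite mem_enum !inE => /or4P[] /eqP ->.
by rewrite -cardE; move: odx; rewrite /outdeg => ->.
Qed.
End NoFarPair.

(** * Pairs at distance at least 3 *)

Definition far (T : finType) (e : rel T) (z x : T) :=
  [&& z != x, ~~ e z x & [disjoint out e z & inn e x]].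

Section FarPair.
Variables (T : finType) (n : nat).
Hypothesis cardT : #|T| = 2 * n.

Section Structure.
Variable e : rel T.
Hypotheses (eI : irreflexive e) (no4 : dicycle4_free e).
Hypotheses (odn : forall v, n <= (outdeg e v).+1).
Hypotheses (idn : forall v, n <= (indeg e v).+1).
Hypotheses (degn : forall v, 2 * n <= (deg e v).+1).

Lemma far_converse z x : far (converse e) x z = far e z x.
Proof. by rewrite /far /converse eq_sym disjoint_sym. Qed.

Lemma not_farP z x : z != x -> ~~ e z x -> ~~ far e z x ->
  exists2 v, e z v & e v x.
Proof.
rewrite /far => -> -> /=; rewrite -setI_eq0 => /set0Pn[v].
by rewrite !inE => /andP[zv vx]; exists v.
Qed.

Lemma far_mid z x v : far e z x -> e z v -> e v x -> False.
Proof.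
case/and3P => _ _ /pred0P/(_ v) /=; rewrite !inE => + zv vx.
by rewrite zv vx.
Qed.

Lemma far_union z x : far e z x ->
  [/\ outdeg e z = n.-1, indeg e x = n.-1 &
      forall v, v != z -> v != x -> e z v = ~~ e v x].
Proof.
move=> Fzx; have /and3P[zx nzx D] := Fzx.
have cU : #|out e z :|: inn e x| = outdeg e z + indeg e x.
  by rewrite cardsU; move: D; rewrite -setI_eq0 => /eqP ->; rewrite cards0 subn0.
have cC : #|~: [set z; x]| = 2 * n - 2.
  by have := cardsC [set z; x]; rewrite cards2 zx cardT; lia.
have sub : out e z :|: inn e x \subset ~: [set z; x].
  apply/subsetP => v; rewrite !inE => h; apply: contraL h => /orP[] /eqP ->.
    by rewrite eI (negbTE nzx).
  by rewrite eI orbF.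
have le := subset_leq_card sub.
have [h1 h2] := (odn z, idn x).
have z_gt0 : 0 < #|T| by apply/card_gt0P; exists z.
split; [lia | lia |].
have /setP E : out e z :|: inn e x = ~: [set z; x].
  by apply/eqP; rewrite eqEcard sub /=; lia.
move=> v vz vx; have := E v; rewrite !inE negb_or vz vx /=.
case: (boolP (e z v)) => [zv _|_ /= ->//].
by apply/esym/negP => /(far_mid Fzx zv).
Qed.

(* The arc xz closes any arc from z |: out z to x |: inn x into a 4-cycle. *)
Lemma far_arc_complete z x : far e z x -> e x z ->
  exists A : {set T}, [/\ #|A| = n, {in A &, forall u v, e u v = (u != v)},
    {in ~: A &, forall u v, e u v = (u != v)} &
    {in ~: A & A, forall b a, ~~ e b a}].
Proof.
move=> Fzx exz; have /and3P[zx nzx _] := Fzx.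
have [oz ix zE] := far_union Fzx.
have n_gt0 : 0 < n by have := max_card (pred1 z); rewrite card1; lia.
have xz : x != z by rewrite eq_sym.
pose A := x |: inn e x.
have cA : #|A| = n by rewrite /A cardsU1 inE eI; move: ix; rewrite /indeg; lia.
have cC : #|~: A| = n by have := cardsC A; lia.
have CA b : b \in ~: A -> b = z \/ e z b.
  rewrite !inE negb_or => /andP[bx nbx].
  by have [->|bz] := eqVneq b z; [left | right; rewrite zE].
have no_arc : {in ~: A & A, forall b a, ~~ e b a}.
  move=> b a bC aA; apply/negP => ba.
  have bnx : ~~ e b x by move: bC; rewrite !inE negb_or => /andP[].
  have ax : e a x.
    by move: aA; rewrite !inE => /orP[/eqP ax|//]; rewrite ax (negbTE bnx) in ba.
  have [bz|zb] := CA _ bC; first by rewrite bz in ba; apply: (far_mid Fzx ba ax).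
  apply: (no4 zb ba ax exz); first by apply: contraNneq nzx => ->.
  by apply: contraNneq nzx => <-.
exists A; split=> //.
  move=> u v uA vA.
  (* No arc enters [A], so [inn e v] lies in [A] minus [v], and the minimum semi-degree makes it
     fill that set. *)
  have /setP/(_ u) : inn e v = A :\ v.
    apply/eqP; rewrite eqEcard; apply/andP; split.
      apply/subsetP => w; rewrite in_setD1 inE => wv; apply/andP; split.
        by apply: contraTneq wv => ->; rewrite eI.
      apply: contraTT wv => wA; apply: no_arc => //.
      by rewrite in_setC.
    by have := cardsD1 v A; rewrite vA cA; have := idn v; rewrite /indeg; lia.
  by rewrite in_setD1 inE uA andbT.
move=> u v uA vA.
have /setP/(_ v) : out e u = (~: A) :\ u.
  apply/eqP; rewrite eqEcard; apply/andP; split.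
    apply/subsetP => w; rewrite in_setD1 in_setC inE => uw; apply/andP; split.
      by apply: contraTneq uw => ->; rewrite eI.
    by apply: contraTN uw => wA; apply: no_arc.
  by have := cardsD1 u (~: A); rewrite uA cC; have := odn u; rewrite /outdeg; lia.
by rewrite in_setD1 inE vA andbT eq_sym.
Qed.

(** A vertex of either half without an arc between the halves would have degree at most 4. *)
Lemma far_arc_H33 z x : n = 3 -> far e z x -> e x z -> in_H33 e.
Proof.
move=> n3 Fzx exz; have [A [cA AA CC CA]] := far_arc_complete Fzx exz.
have cC : #|~: A| = 3 by have := cardsC A; lia.
exists A, (~: A); split=> //.
- by rewrite setUCr disjoints_subset setCK subxx cA n3 cC.
split=> [a aA|b bC]; apply/exists_inP; apply: contraT => /exists_inPn H; exfalso.
  have oa : out e a \subset A :\ a.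
    apply/subsetP => v; rewrite in_setD1 inE => av; apply/andP; split.
      by apply: contraTneq av => ->; rewrite eI.
    by apply: contraTT av => vA; apply: H; rewrite in_setC.
  have ia : inn e a \subset A :\ a.
    apply/subsetP => v; rewrite in_setD1 inE => va; apply/andP; split.
      by apply: contraTneq va => ->; rewrite eI.
    by apply: contraTT va => vA; apply: CA; rewrite ?in_setC.
  have := subset_leq_card oa; have := subset_leq_card ia; have := degn a.
  by have := cardsD1 a A; rewrite aA cA /deg /indeg /outdeg; lia.
have ib : inn e b \subset (~: A) :\ b.
  apply/subsetP => v; rewrite in_setD1 in_setC inE => vb; apply/andP; split.
    by apply: contraTneq vb => ->; rewrite eI.
  by apply: contraTN vb => /H.
have ob : out e b \subset (~: A) :\ b.
  apply/subsetP => v; rewrite in_setD1 in_setC inE => bv; apply/andP; split.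
    by apply: contraTneq bv => ->; rewrite eI.
  by apply: contraTN bv => vA; apply: CA.
have := subset_leq_card ob; have := subset_leq_card ib; have := degn b.
by have := cardsD1 b (~: A); rewrite bC cC /deg /indeg /outdeg; lia.
Qed.

(** * Far pairs in even order at least 8 *)

Hypothesis n_gt3 : 3 < n.

(** An arc [x z] would give a complete set of [n > 3] vertices, which contains a 4-cycle. *)
Lemma far_nonadj z x : far e z x -> ~~ e x z.
Proof.
move=> Fzx; apply/negP => exz; have [A [cA AA _ _]] := far_arc_complete Fzx exz.
have : 3 < size (enum A) by rewrite -cardE cA.
have := enum_uniq A; have mA v : v \in enum A -> v \in A by rewrite mem_enum.
case: (enum A) mA => [|a [|b [|c [|d r]]]] //= mA + _.
rewrite !inE !negb_or -!andbA => /and5P[ab ac ad _ /and4P[bc bd _ /andP[cd _]]].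
have [aA bA cA' dA] : [/\ a \in A, b \in A, c \in A & d \in A].
  by split; apply: mA; rewrite !inE eqxx ?orbT.
by apply: (no4 (a := a) (b := b) (c := c) (d := d)); rewrite ?AA // eq_sym.
Qed.

Section Pair.
Variables (z x : T).
Hypothesis Fzx : far e z x.

Let zE v : v != z -> v != x -> e z v = ~~ e v x.
Proof. by move: v; case: (far_union Fzx). Qed.
Let zx : ~~ e z x. Proof. by case/and3P: Fzx. Qed.
Let xz : ~~ e x z. Proof. exact: far_nonadj. Qed.

Lemma far_in_z : n <= indeg e z.
Proof. by have [oz _ _] := far_union Fzx; have := degn z; rewrite /deg oz; lia. Qed.

Lemma far_out_x : n <= outdeg e x.
Proof. by have [_ ix _] := far_union Fzx; have := degn x; rewrite /deg ix; lia. Qed.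

Let out_zN v : e z v -> e v x -> False.
Proof. exact: far_mid. Qed.

Let zN_in w : e w x -> ~~ e z w.
Proof. by move=> wx; apply/negP => /out_zN; apply. Qed.

Lemma far_no_mid w b c : e w z -> e w x -> e z b -> e b c -> e c w -> False.
Proof.
move=> wz wx zb bc cw; apply: (no4 zb bc cw wz).
  by apply: contraTneq cw => <-; apply: zN_in.
by apply: contraTneq zb => ->; apply: zN_in.
Qed.

Lemma far_or_arc w b : e w z -> e w x -> e z b -> e b w || far e b w.
Proof.
move=> wz wx zb; have [//|bw /=] := boolP (e b w).
rewrite /far bw /=; apply/andP; split.
  by apply: contraTneq zb => ->; apply: zN_in.
apply/pred0P => c /=; rewrite !inE; apply/negP => /andP[bc cw].
exact: (far_no_mid wz wx zb bc cw).
Qed.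

(** Otherwise [b a x c] is a 4-cycle. *)
Lemma far_in_b b a c : e z b -> e a x -> e b a -> e x c -> e c b -> c = a.
Proof.
move=> zb ax ba xc cb; apply/eqP; apply: contraT => ca; exfalso.
apply: (no4 ba ax xc cb); first by apply: contraTneq zb => ->.
by rewrite eq_sym.
Qed.

Lemma far_out_a b a c : e z b -> e a x -> e b a -> e a c -> e c z -> c = b.
Proof.
move=> zb ax ba ac cz; apply/eqP; apply: contraT => cb; exfalso.
apply: (no4 zb ba ac cz); first by apply: contraTneq ax => <-.
by rewrite eq_sym.
Qed.

(** Otherwise [far_union] would place the at least [n] vertices of [inn e z] in [out e z], which has
    [n - 1]. *)
Lemma far_witness : exists2 w, e w z & e w x.
Proof.
apply/exists_inP; apply: contraT => /exists_inPn H; exfalso.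
have : inn e z \subset out e z.
  apply/subsetP => v; rewrite !inE => vz; rewrite zE ?H //.
    by apply: contraTneq vz => ->; rewrite eI.
  by apply: contraTneq vz => ->.
move/subset_leq_card; have := far_in_z; have [oz _ _] := far_union Fzx.
by move: oz; rewrite /indeg /outdeg; lia.
Qed.

Lemma two_others b0 : exists b1 b2, [/\ e z b1, e z b2, b1 != b0, b2 != b0 & b1 != b2].
Proof.
have [oz _ _] := far_union Fzx.
have /card_gt1P[b1 [b2 [h1 h2 b12]]] : 1 < #|out e z :\ b0|.
  by have := cardsD1 b0 (out e z); move: oz; rewrite /outdeg; lia.
by move: h1 h2; rewrite !inE => /andP[? ?] /andP[? ?]; exists b1, b2.
Qed.

(** An arc [b w] from another [b] in [out e z] would close [z b0 b w], so [w] is far from [b]. Then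
    [far_union] yields the arcs [b1 b2] and [b2 z], and [z b0 b1 b2] is a 4-cycle. *)
Lemma no_dominating b0 : e z b0 -> (forall b, e z b -> b != b0 -> e b0 b) -> False.
Proof.
move=> zb0 dom; have [w wz wx] := far_witness.
have farw b : e z b -> b != b0 -> far e b w.
  move=> zb bb0; have /orP[bw|//] := far_or_arc wz wx zb.
  by case: (far_no_mid wz wx zb0 (dom _ zb bb0) bw).
have [b1 [b2 [zb1 zb2 b10 b20 b12]]] := two_others b0.
have arc u v : far e u w -> v != u -> v != w -> ~~ e v w -> e u v.
  by move=> /far_union[_ _ uE] vu vw nvw; rewrite uE.
have nw b : e z b -> b != w by move=> zb; apply: contraTneq zb => ->; apply: zN_in.
have b1b2 : e b1 b2.
  apply: arc; rewrite ?farw ?nw //; first by rewrite eq_sym.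
  by have /and3P[] := farw _ zb2 b20.
have b2z : e b2 z.
  apply: arc; rewrite ?farw ?zN_in //.
    by apply: contraTneq zb2 => ->; rewrite eI.
  by apply: contraTneq wz => ->; rewrite eI.
apply: (no4 zb0 (dom _ zb1 b10) b1b2 b2z); last by rewrite eq_sym.
by apply: contraTneq zb1 => <-; rewrite eI.
Qed.

(** Otherwise [out e b] has only [z] and the rest of [out e z] available, [n - 1] vertices in all,
    and [b] dominates that rest. *)
Lemma far_out_z_arc b : e z b -> exists2 a, e a x & e b a.
Proof.
move=> zb; apply/exists_inP; apply: contraT => /exists_inPn H; exfalso.
have bx : b != x by apply: contraTneq zb => ->.
have bz : b != z by apply: contraTneq zb => ->; rewrite eI.
have nbx : ~~ e b x by rewrite -zE.
have /setP E : out e b = z |: (out e z :\ b).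
  apply/eqP; rewrite eqEcard; apply/andP; split.
    apply/subsetP => v; rewrite !inE => bv.
    have [//|vz /=] := eqVneq v z; apply/andP; split.
      by apply: contraTneq bv => ->; rewrite eI.
    have vx : v != x by apply: contraTneq bv => ->.
    by rewrite zE //; apply: contraTN bv => /H.
  rewrite cardsU1 !inE eI andbF /=.
  have := cardsD1 b (out e z); rewrite inE zb.
  have [oz _ _] := far_union Fzx; move: oz; have := odn b.
  by rewrite /outdeg; lia.
apply: (no_dominating zb) => b' zb' b'b.
by have := E b'; rewrite !inE b'b zb' orbT.
Qed.

(** Without the arc, [out e x] and [inn e b] are too large to be disjoint. By [far_in_b] they share
    a single vertex [c], the only possible out-neighbour of [b] in [inn e x]. So [inn e b] has
    minimum size, [out e b] has at least [n] vertices, and [b] dominates the rest of [out e z]. *)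
Lemma far_x_out b : e z b -> e x b.
Proof.
move=> zb; apply: contraT => xb; exfalso.
have bx : b != x by apply: contraTneq zb => ->.
have bz : b != z by apply: contraTneq zb => ->; rewrite eI.
have nbx : ~~ e b x by rewrite -zE.
have [a ax ba] := far_out_z_arc zb.
have subI : out e x :|: inn e b \subset ~: [set x; b].
  apply/subsetP => v; rewrite !inE => h; apply: contraL h => /orP[] /eqP ->.
    by rewrite eI (negbTE xb).
  by rewrite eI (negbTE xb).
have cC : #|~: [set x; b]| = 2 * n - 2.
  by have := cardsC [set x; b]; rewrite cards2 eq_sym bx cardT; lia.
have cI : 0 < #|out e x :&: inn e b| -> exists2 c, e x c & e c b.
  by case/card_gt0P => c; rewrite !inE => /andP[]; exists c.
have UI := cardsUI (out e x) (inn e b).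
have le := subset_leq_card subI.
have hx := far_out_x; have hb := idn b; rewrite /outdeg in hx; rewrite /indeg in hb.
have [c xc cb] : exists2 c, e x c & e c b by apply: cI; lia.
have uniq_a a' : e a' x -> e b a' -> a' = c.
  by move=> a'x ba'; rewrite (far_in_b zb a'x ba' xc cb).
have le1 : #|out e x :&: inn e b| <= 1.
  apply/card_le1_eqP => u v; rewrite !inE => /andP[xu ub] /andP[xv vb].
  by rewrite (far_in_b zb ax ba xu ub) (far_in_b zb ax ba xv vb).
have odb : n <= outdeg e b by have := degn b; rewrite /deg /indeg; lia.
have /setP E : out e b = c |: (z |: (out e z :\ b)).
  apply/eqP; rewrite eqEcard; apply/andP; split.
    apply/subsetP => v; rewrite !inE => bv.
    have [//|vc /=] := eqVneq v c.
    have [//|vz /=] := eqVneq v z; apply/andP; split.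
      by apply: contraTneq bv => ->; rewrite eI.
    have vx : v != x by apply: contraTneq bv => ->.
    by rewrite zE //; apply: contraNN vc => v_x; rewrite (uniq_a v).
  rewrite !cardsU1 !inE eI andbF /=.
  have := cardsD1 b (out e z); rewrite inE zb.
  have [oz _ _] := far_union Fzx; move: oz odb.
  rewrite /outdeg; case: (~~ _); lia.
apply: (no_dominating zb) => b' zb' b'b.
by have := E b'; rewrite !inE b'b zb' !orbT.
Qed.

(** With [a] from [far_out_z_arc], an arc [b' b] closes the 4-cycle [b a x b'], unless [b' = a], and
    then [z a x] is a path. *)
Lemma far_indep b b' : e z b -> e z b' -> ~~ e b' b.
Proof.
move=> zb zb'; apply/negP => b'b; have [a ax ba] := far_out_z_arc zb.
have b'a := far_in_b zb ax ba (far_x_out zb') b'b.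
by rewrite b'a in zb'; apply: (out_zN zb').
Qed.

(** The hypothesis is [far_x_out] for the converse. Given a 2-cycle [z b] and a common in-neighbour
    [a] of [b] and [x], [a] is far from all other vertices of [out e z]; [far_union] then puts an
    arc inside this independent set. *)
Lemma far_pair_false_aux : (forall a, e a x -> e a z) -> False.
Proof.
move=> Az; have [oz ix _] := far_union Fzx.
have [b bz zb] : exists2 b, e b z & e z b.
  apply/exists_inP; apply: contraT => /exists_inPn H; exfalso.
  have : inn e z \subset inn e x.
    apply/subsetP => v; rewrite !inE => vz.
    have v_z : v != z by apply: contraTneq vz => ->; rewrite eI.
    have v_x : v != x by apply: contraTneq vz => ->.
    by have := H _ vz; rewrite zE // negbK.
  move/subset_leq_card; have := far_in_z; move: ix; rewrite /indeg; lia.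
have [a ax ab] : exists2 a, e a x & e a b.
  apply/exists_inP; apply: contraT => /exists_inPn H; exfalso.
  have : inn e b \subset [set x; z].
    apply/subsetP => v; rewrite !inE => vb; apply: contraT.
    rewrite negb_or => /andP[vx vz].
    have vx' : ~~ e v x by apply: contraTN vb => /H.
    have zv : e z v by rewrite zE.
    by have /negP := far_indep zb zv.
  move/subset_leq_card; rewrite cards2; have := idn b; rewrite /indeg.
  by case: (_ != _); lia.
have az := Az _ ax.
have F b' : e z b' -> b' != b -> far e b' a.
  move=> zb' b'b; have /orP[b'a|//] := far_or_arc az ax zb'.
  by rewrite (far_out_a zb' ax b'a ab bz) eqxx in b'b.
have [b1 [b2 [zb1 zb2 b1b b2b b12]]] := two_others b.
have [_ _ E] := far_union (F _ zb1 b1b).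
have /negP[] := far_indep zb2 zb1; rewrite E.
- by have /and3P[] := F _ zb2 b2b.
- by rewrite eq_sym.
- by apply: contraTneq zb2 => ->; apply: zN_in.
Qed.

End Pair.
End Structure.

Lemma far_pair_false (e : rel T) z x :
  irreflexive e -> dicycle4_free e ->
  (forall v, n <= (outdeg e v).+1) -> (forall v, n <= (indeg e v).+1) ->
  (forall v, 2 * n <= (deg e v).+1) -> 3 < n -> far e z x -> False.
Proof.
move=> eI no4 odn idn degn n_gt3 F.
apply: (@far_pair_false_aux e _ _ _ _ _ _ z x F) => // a ax.
apply: (@far_x_out (converse e) _ _ _ _ _ _ x z) => //.
- exact: converse_dicycle4_free.
- by move=> v; rewrite /deg addnC; apply: degn.
- by rewrite far_converse.
Qed.

End FarPair.

(** * Orders 5 and 6 *)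

Definition bmat := seq (seq bool).
Definition mget (M : bmat) (i j : nat) : bool := nth false (nth [::] M i) j.
Definition mset (M : bmat) (i j : nat) (b : bool) : bmat :=
  set_nth [::] M i (set_nth false (nth [::] M i) j b).

Lemma mget_mset M i j b i' j' :
  mget (mset M i j b) i' j' = if (i' == i) && (j' == j) then b else mget M i' j'.
Proof.
rewrite /mget /mset nth_set_nth /=; case: eqP => [->|//] /=.
by rewrite nth_set_nth /=.
Qed.

Section Search.
Variables (p s d : nat) (test : bmat -> bool).

Definition cycle4_through (L : bmat) (i j : nat) : bool :=
  has (fun a => [&& mget L j a, i != a &
    has (fun b => [&& mget L a b, mget L b i & j != b]) (iota 0 p)]) (iota 0 p).

Definition degrees_ok (U : rel nat) (v : nat) : bool :=
  let o := count (U v) (iota 0 p) in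
  let i := count (U^~ v) (iota 0 p) in
  [&& s <= o, s <= i & d <= o + i].

(* Invariant: L and U are a lower and an upper bound of the adjacency matrix,
   and agree outside [vars]. *)
Fixpoint search (vars : seq (nat * nat)) (L U : bmat) : bool :=
  match vars with
  | [::] => (L == U) && test L
  | (i, j) :: vs =>
      let L' := mset L i j true in
      let U' := mset U i j false in
      (cycle4_through L' i j || search vs L' U) &&
      (~~ (degrees_ok (mget U') i && degrees_ok (mget U') j) || search vs L U')
  end.

(** Pairs with vertex 0 are left out because [search_codes] has fixed them. *)
Definition search_vars : seq (nat * nat) :=
  flatten [seq flatten [seq [:: (i, j); (j, i)] | j <- iota i.+1 (p - i.+1)]
          | i <- iota 1 p.-1].

Definition set_code (M : bmat) (j c : nat) : bmat :=
  mset (mset M 0 j (1 < c)) j 0 (odd c).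

(* Symmetry breaking: the vertices 1, ..., p - 1 are sorted by the code
   2 * (0 -> i) + (i -> 0). *)
Fixpoint search_codes (k j lo : nat) (L U : bmat) : bool :=
  match k with
  | 0 => ~~ degrees_ok (mget U) 0 || search search_vars L U
  | k'.+1 => all (fun c => (c < lo) ||
      search_codes k' j.+1 c (set_code L j c) (set_code U j c)) [:: 0; 1; 2; 3]
  end.

Definition search_all : bool :=
  search_codes p.-1 1 0 (nseq p (nseq p false))
    [seq [seq i != j | j <- iota 0 p] | i <- iota 0 p].

Variable M : rel nat.
Hypothesis M_lt : forall i j, M i j -> (i < p) && (j < p).
Hypothesis MI : forall i, M i i = false.
Hypothesis M4 : dicycle4_free M.
Hypothesis Mdeg : forall v, v < p -> degrees_ok M v.
Hypothesis Msorted : forall i, 0 < i -> i.+1 < p ->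
  2 * M 0 i + M i 0 <= 2 * M 0 i.+1 + M i.+1 0.

Let below (L : bmat) := forall i j, mget L i j -> M i j.
Let above (U : bmat) := forall i j, M i j -> mget U i j.

Lemma below_set L i j (b : bool) : below L -> (b -> M i j) -> below (mset L i j b).
Proof.
move=> LM h i' j'; rewrite mget_mset; case: ifP => [/andP[/eqP-> /eqP->]//|_].
exact: LM.
Qed.

Lemma above_set U i j (b : bool) : above U -> (M i j -> b) -> above (mset U i j b).
Proof.
move=> UM h i' j'; rewrite mget_mset; case: ifP => [/andP[/eqP-> /eqP->]//|_].
exact: UM.
Qed.

Lemma cycle4_through_false L i j :
  below L -> M i j -> cycle4_through L i j -> False.
Proof.
move=> LM ij /hasP[a _ /and3P[ja ia /hasP[b _ /and3P[ab bi jb]]]].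
by apply: (M4 ij (LM _ _ ja) (LM _ _ ab) (LM _ _ bi)).
Qed.

Lemma degrees_ok_above U v : above U -> v < p -> degrees_ok (mget U) v.
Proof.
move=> UM /Mdeg /and3P[h1 h2 h3].
have ho : count (M v) (iota 0 p) <= count (mget U v) (iota 0 p).
  by apply: sub_count => w; apply: UM.
have hi : count (M^~ v) (iota 0 p) <= count ((mget U)^~ v) (iota 0 p).
  by apply: sub_count => w; apply: UM.
rewrite /degrees_ok; apply/and3P; split; lia.
Qed.

(** The branch agreeing with [M] survives both prunings: a 4-cycle in the lower bound would lie in
    [M], and the upper bound has at least the degrees of [M]. *)
Lemma search_sound vars L U :
  all (fun q => (q.1 < p) && (q.2 < p)) vars -> below L -> above U ->
  search vars L U -> exists2 N, test N & mget N =2 M.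
Proof.
elim: vars L U => [|[i j] vs IH] L U /=.
  move=> _ LM UM /andP[/eqP LU tL]; exists L => // i j.
  by apply/idP/idP => [/LM//|/UM]; rewrite LU.
move=> /andP[/andP[ip jp] vsp] LM UM /andP[h1 h2].
have [ij|ij] := boolP (M i j).
  have LM' : below (mset L i j true) by apply: below_set.
  by case/orP: h1 => [/(cycle4_through_false LM' ij)|] //; apply: IH.
have UM' : above (mset U i j false) by apply: above_set; rewrite // (negbTE ij).
by move: h2; rewrite !degrees_ok_above //=; apply: IH.
Qed.

Lemma search_vars_lt : all (fun q => (q.1 < p) && (q.2 < p)) search_vars.
Proof.
apply/allP => q /flattenP[r /mapP[i]]; rewrite mem_iota => ip ->.
case/flattenP => t /mapP[j]; rewrite mem_iota => jp ->.
by rewrite !inE => /orP[] /eqP -> /=; lia.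
Qed.

Lemma set_codeE c j : c = 2 * M 0 j + M j 0 -> (1 < c) = M 0 j /\ odd c = M j 0.
Proof. by move=> ->; case: (M 0 j); case: (M j 0). Qed.

Lemma search_codes_sound k j lo L U :
  0 < p -> 0 < j -> j + k = p -> (j < p -> lo <= 2 * M 0 j + M j 0) ->
  below L -> above U -> search_codes k j lo L U ->
  exists2 N, test N & mget N =2 M.
Proof.
move=> p_gt0; elim: k j lo L U => [|k IH] j lo L U j_gt0 jk lo_le LM UM.
  rewrite /= degrees_ok_above //=; apply: search_sound => //.
  exact: search_vars_lt.
have jp : j < p by lia.
move=> /allP H.
pose c := 2 * M 0 j + M j 0.
have [c1 c2] := set_codeE (erefl c).
have /H : c \in [:: 0; 1; 2; 3] by rewrite /c; case: (M 0 j); case: (M j 0).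
case/orP => [|]; first by have := lo_le jp; rewrite -/c; lia.
apply: IH => //; first by lia.
- by move=> j1; apply: Msorted.
- by rewrite /set_code c1 c2; do 2 apply: below_set => //.
- by rewrite /set_code c1 c2; do 2 apply: above_set => //.
Qed.

Lemma search_all_sound : 0 < p -> search_all -> exists2 N, test N & mget N =2 M.
Proof.
move=> p_gt0; apply: search_codes_sound => //; first by lia.
  move=> i j; rewrite /mget nth_nseq; case: ifP => _;
    by rewrite ?nth_nseq ?if_same ?nth_nil.
move=> i j ij; have /andP[ip jp] := M_lt ij.
rewrite /mget (nth_map 0) ?size_iota // nth_iota // (nth_map 0) ?size_iota //.
by rewrite nth_iota // !add0n; apply: contraTneq ij => ->; rewrite MI.
Qed.

End Search.

Section SearchDigraph.
Variables (T : finType) (e : rel T) (s d : nat) (test : bmat -> bool).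
Hypotheses (eI : irreflexive e) (no4 : dicycle4_free e).
Hypotheses (ods : forall v, s <= outdeg e v) (ids : forall v, s <= indeg e v).
Hypothesis degd : forall v, d <= deg e v.

Lemma search_digraph (x0 : T) : search_all #|T| s d test ->
  exists (l : seq T) (N : bmat),
    [/\ test N, uniq l, forall x, x \in l, size l = #|T| &
        forall i j, i < #|T| -> j < #|T| ->
          mget N i j = e (nth x0 l i) (nth x0 l j)].
Proof.
pose code x := 2 * e x0 x + e x x0.
pose leT := relpre code leq.
(* The order of the vertices that the symmetry breaking presupposes, with [x0] as vertex 0. *)
pose l := x0 :: sort leT (rem x0 (enum T)).
have lE : perm_eq l (enum T).
  have x0T : x0 \in enum T by rewrite mem_enum.
  by rewrite (permPr (perm_to_rem x0T)) perm_cons perm_sort.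
have ul : uniq l by rewrite (perm_uniq lE) enum_uniq.
have lT x : x \in l by rewrite (perm_mem lE) mem_enum.
have sl : size l = #|T| by rewrite (perm_size lE) cardE.
pose p := #|T|.
(* The cut at [p] matters, since [nth] returns the vertex [x0] out of range. *)
pose M i j := [&& i < p, j < p & e (nth x0 l i) (nth x0 l j)].
have cntE (P : pred T) : #|[set y | P y]| = count (fun i => P (nth x0 l i)) (iota 0 p).
  rewrite -(count_map (nth x0 l)) -/(mkseq _ _) /p -sl mkseq_nth.
  rewrite -size_filter -(card_uniqP (filter_uniq P ul)).
  by apply: eq_card => y; rewrite inE mem_filter lT andbT.
have ct (P Q : pred nat) : (forall i, i < p -> P i = Q i) ->
    count P (iota 0 p) = count Q (iota 0 p).
  by move=> PQ; apply: eq_in_count => i; rewrite mem_iota => /PQ.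
move=> /(@search_all_sound _ _ _ _ M) H.
have /H[] : forall i j, M i j -> (i < p) && (j < p).
  by move=> i j /and3P[-> ->].
- by move=> i; rewrite /M eI !andbF.
- move=> a b c t /and3P[ap bp ab] /and3P[_ cp bc] /and3P[_ tp ct'] /and3P[_ _ ta] ac bt.
  by apply: (no4 ab bc ct' ta); rewrite nth_uniq // sl.
- move=> v vp; rewrite /degrees_ok.
  have -> : count (M v) (iota 0 p) = outdeg e (nth x0 l v).
    by rewrite /outdeg cntE; apply: ct => i ip; rewrite /M vp ip.
  have -> : count (M^~ v) (iota 0 p) = indeg e (nth x0 l v).
    by rewrite /indeg cntE; apply: ct => i ip; rewrite /M vp ip.
  by rewrite ods ids degd.
- have : sorted leT (sort leT (rem x0 (enum T))).
    by apply: sort_sorted => x y; apply: leq_total.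
  move/(sortedP x0) => Hs [//|i] _ ip.
  have := Hs i; rewrite -ltnS -[X in _ < X]/(size l) sl => /(_ ip).
  have p_gt0 : 0 < #|T| by apply: leq_ltn_trans ip.
  by rewrite /leT /code /= /M (ltnW ip) ip p_gt0.
- by apply/card_gt0P; exists x0.
move=> N tN NM; exists l, N; split=> // i j ip jp.
by rewrite NM /M ip jp.
Qed.

End SearchDigraph.

(** * Recognizing the exceptional digraphs *)

Definition iso_test (p : nat) (H N : bmat) : bool :=
  has (fun g => all (fun i => all (fun j =>
    mget N i j == mget H (nth 0 g i) (nth 0 g j)) (iota 0 p)) (iota 0 p))
    (permutations (iota 0 p)).

Definition mat_of (T : Type) (e : rel T) (t : seq T) : bmat :=
  [seq [seq e a b | b <- t] | a <- t].

Lemma iso_test_diso (T T' : finType) (e : rel T) (e' : rel T') (N : bmat)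
    (x0 : T) (y0 : T') (l : seq T) (t : seq T') :
  uniq l -> uniq t -> (forall x, x \in l) -> (forall y, y \in t) ->
  size l = size t ->
  (forall i j, i < size l -> j < size l ->
     mget N i j = e (nth x0 l i) (nth x0 l j)) ->
  iso_test (size t) (mat_of e' t) N -> diso e e'.
Proof.
move=> ul ut lT tT st NE /hasP[g]; rewrite mem_permutations => gE /allP H.
pose t' := [seq nth y0 t i | i <- g].
have sg : size g = size t by rewrite (perm_size gE) size_iota.
have tE : perm_eq t' t.
  rewrite -[X in perm_eq _ X](mkseq_nth y0 t); exact: perm_map.
have g_lt i : i < size t -> nth 0 g i < size t.
  move=> it; have : nth 0 g i \in iota 0 (size t).
    by rewrite -(perm_mem gE) mem_nth ?sg.
  by rewrite mem_iota.
apply: (@diso_lists _ _ e e' x0 y0 l t') => //.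
- by rewrite (perm_uniq tE).
- by rewrite size_map sg.
- by move=> y; rewrite (perm_mem tE).
move=> i j il jl; rewrite -NE // /t'; move: il jl; rewrite st => il jl.
have /H/allP/(_ j) : i \in iota 0 (size t) by rewrite mem_iota.
rewrite mem_iota => /(_ jl)/eqP ->.
rewrite /mget /mat_of (nth_map y0) ?g_lt // (nth_map y0) ?g_lt //.
by rewrite !(nth_map 0) ?sg.
Qed.

Definition ords5 : seq 'I_5 :=
  [:: @Ordinal 5 0 isT; @Ordinal 5 1 isT; @Ordinal 5 2 isT; @Ordinal 5 3 isT;
      @Ordinal 5 4 isT].
Definition ords6 : seq 'I_6 :=
  [:: @Ordinal 6 0 isT; @Ordinal 6 1 isT; @Ordinal 6 2 isT; @Ordinal 6 3 isT;
      @Ordinal 6 4 isT; @Ordinal 6 5 isT].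
Definition two_triangles_vertices : seq ('I_2 + 'I_2 + 'I_1) :=
  [:: inl (inl (@Ordinal 2 0 isT)); inl (inl (@Ordinal 2 1 isT));
      inl (inr (@Ordinal 2 0 isT)); inl (inr (@Ordinal 2 1 isT));
      inr (@Ordinal 1 0 isT)].

Definition two_triangles : rel ('I_2 + 'I_2 + 'I_1) :=
  symdi (graph_join (graph_union (complete_graph 2) (complete_graph 2))
                    (complete_graph 1)).

Definition test5 (N : bmat) : bool :=
  iso_test 5 (mat_of (symdi (cycle_graph 5)) ords5) N ||
  iso_test 5 (mat_of two_triangles two_triangles_vertices) N.

(** By [far_arc_H33] an arc [x z] with [far e z x] already certifies H(3,3), so its members need not
    be listed. *)
Definition far_arc_test (N : bmat) : bool :=
  has (fun x => has (fun z => [&& mget N x z, ~~ mget N z x &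
    ~~ has (fun v => mget N z v && mget N v x) (iota 0 6)]) (iota 0 6)) (iota 0 6).

Definition test6 (N : bmat) : bool :=
  [|| far_arc_test N, iso_test 6 (mat_of H6' ords6) N,
      iso_test 6 (mat_of H6'' ords6) N | iso_test 6 (mat_of C6_1 ords6) N].

(* [lazy] and not [vm_compute], which would evaluate both arguments of [||] and
   so never prune. *)
Lemma search5 : search_all 5 2 4 test5.
Proof. by lazy. Qed.

Lemma search6 : search_all 6 2 5 test6.
Proof. by lazy. Qed.

Section SmallOrders.
Variables (T : finType) (e : rel T).
Hypotheses (eI : irreflexive e) (no4 : dicycle4_free e).
Hypotheses (od2 : forall v, 2 <= outdeg e v) (id2 : forall v, 2 <= indeg e v).
Hypothesis degp : forall v, #|T| <= (deg e v).+1.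

Lemma dicycle4_free_order5 : #|T| = 5 ->
  diso e (symdi (cycle_graph 5)) \/ diso e two_triangles.
Proof.
move=> T5; have /card_gt0P[x0 _] : 0 < #|T| by rewrite T5.
have deg4 v : 4 <= deg e v by have := degp v; rewrite T5.
have := @search_digraph _ e 2 4 test5 eI no4 od2 id2 deg4 x0.
rewrite T5 => /(_ search5)[l [N [tN ul lT sl NE]]].
case/orP: tN => tN; [left | right].
  by apply: (@iso_test_diso _ _ _ _ N x0 ord0 l ords5) => //;
    [move=> [[|[|[|[|[|?]]]]] ?] | rewrite sl].
apply: (@iso_test_diso _ _ _ _ N x0 (inr ord0) l two_triangles_vertices) => //;
  last by rewrite sl.
by move=> [[[[|[|?]] ?]|[[|[|?]] ?]]|[[|?] ?]].
Qed.

Lemma dicycle4_free_order6 : #|T| = 6 ->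
  diso e H6' \/ diso e H6'' \/ diso e C6_1 \/ in_H33 e.
Proof.
move=> T6; have /card_gt0P[x0 _] : 0 < #|T| by rewrite T6.
have deg5 v : 5 <= deg e v by have := degp v; rewrite T6.
have := @search_digraph _ e 2 5 test6 eI no4 od2 id2 deg5 x0.
rewrite T6 => /(_ search6)[l [N [tN ul lT sl NE]]].
have iso (H : rel 'I_6) : iso_test 6 (mat_of H ords6) N -> diso e H.
  move=> tH; apply: (@iso_test_diso _ _ _ _ N x0 ord0 l ords6) => //;
    last by rewrite sl.
  by move=> [[|[|[|[|[|[|?]]]]]] ?].
case/or4P: tN => [|/iso|/iso|/iso]; [|by left|by right; left|by right; right; left].
case/hasP => i + /hasP[j + /and3P[]]; rewrite !mem_iota !add0n !leq0n => i6 j6.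
rewrite !NE // => ij ji /hasPn nv; do 3 right.
apply: (@far_arc_H33 _ 3 _ e eI _ _ _ _ (nth x0 l j) (nth x0 l i)) => //.
rewrite /far ji (contraTneq _ ij) /=; last by move=> ->; rewrite eI.
apply/pred0P => v /=; rewrite !inE; apply: contraNF (nv (index v l) _).
  have v6 : index v l < 6 by rewrite -sl index_mem.
  by rewrite !NE // nth_index.
by rewrite mem_iota /= -sl index_mem.
Qed.

End SmallOrders.

(** * The two dichotomies *)

Lemma dicycle3_or_free (T : finType) (e : rel T) :
  irreflexive e -> has_dicycle e 3 \/ dicycle3_free e.
Proof.
move=> eI; have [/existsP[c h]|/existsPn H] :=
  boolP [exists c : 3.-tuple T, cycle e c && uniq c].
  by left; exists c.
right=> x y z xy yz zx; have /negP[] := H [tuple x; y; z].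
rewrite /= xy yz zx !inE negb_or !andbT /=.
have ne u v : e u v -> u != v by apply: contraTneq => ->; rewrite eI.
by rewrite (eq_sym x z) !ne.
Qed.

Lemma dicycle4_or_free (T : finType) (e : rel T) :
  irreflexive e -> has_dicycle e 4 \/ dicycle4_free e.
Proof.
move=> eI; have [/existsP[c h]|/existsPn H] :=
  boolP [exists c : 4.-tuple T, cycle e c && uniq c].
  by left; exists c.
right=> a b c d ab bc cd da ac bd; have /negP[] := H [tuple a; b; c; d].
rewrite /= ab bc cd da !inE !negb_or ac bd !andbT /=.
have ne u v : e u v -> u != v by apply: contraTneq => ->; rewrite eI.
by rewrite (eq_sym a d) !ne.
Qed.

Lemma bigminn_le (I : finType) (F : I -> nat) (k : nat) (i : I) :
  \big[minn/k]_j F j <= F i.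
Proof.
have : i \in index_enum I by rewrite mem_index_enum.
elim: (index_enum I) => // j r IH; rewrite big_cons inE geq_min.
by case/predU1P => [->|/IH ->]; rewrite ?leqnn ?orbT.
Qed.

(** * Case analysis by order and parity *)

Section Main.
Variables (T : finType) (e : rel T).
Hypotheses (eI : irreflexive e) (p_ge5 : 5 <= #|T|).
Hypotheses (odp : forall v, #|T| <= 2 * outdeg e v + 2).
Hypotheses (idp : forall v, #|T| <= 2 * indeg e v + 2).
Hypothesis degp : forall v, #|T| <= (deg e v).+1.

Lemma dicycle3_free_cases : dicycle3_free e ->
  (exists n : nat, #|T| = 2 * n /\
      iso_spanning_sub e (symdi (complete_bipartite n n))) \/
  diso e (symdi (cycle_graph 5)) \/
  (exists n : nat, #|T| = 2 * n + 1 /\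
      diso e (symdi (complete_bipartite n (n + 1)))).
Proof.
move=> no3; pose n := #|T|./2.
have [Todd|Teven] := boolP (odd #|T|); last first.
  have cT : #|T| = 2 * n by rewrite -(odd_double_half #|T|) (negbTE Teven) -/n; lia.
  left; exists n; split=> //; apply: even_no_triangle_bipartite => // [|v|v|v].
  - lia.
  - by have := odp v; lia.
  - by have := idp v; lia.
  - by have := degp v; lia.
have cT : #|T| = 2 * n + 1 by rewrite -(odd_double_half #|T|) Todd -/n; lia.
have n_gt1 : 1 < n by lia.
have odn v : n <= outdeg e v by have := odp v; lia.
have idn v : n <= indeg e v by have := idp v; lia.
right.
have bip (P : {set T}) : #|P| = n + 1 -> (forall u v, e u v = ((u \in P) != (v \in P))) ->
    exists m, #|T| = 2 * m + 1 /\ diso e (symdi (complete_bipartite m (m + 1))).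
  move=> cP eP; exists n; split=> //;
    apply: (diso_complete_bipartite cP _ eP).
  by have := cardsC P; lia.
have [/existsP[x xbig]|/existsPn small_in] := boolP [exists x, n < indeg e x].
  have [P cP eP] := odd_big_indegree cT n_gt1 eI no3 odn idn xbig.
  by right; apply: bip eP.
have [/existsP[x xbig]|/existsPn small_out] := boolP [exists x, n < outdeg e x].
  have [P cP eP] := @odd_big_indegree T n cT n_gt1 (converse e) x eI
    (converse_dicycle3_free no3) idn odn xbig.
  by right; apply: bip cP _ => u v; rewrite eq_sym -eP.
left; apply: (@odd_regular_C5 T n) => // v; apply/eqP; rewrite eqn_leq.
  by rewrite odn andbT leqNgt.
by rewrite idn andbT leqNgt.
Qed.

Lemma dicycle4_free_cases : dicycle4_free e ->
  diso e (symdi (cycle_graph 5)) \/ diso e H6' \/ diso e H6'' \/ diso e C6_1 \/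
  diso e two_triangles \/ in_H33 e.
Proof.
move=> no4.
have [T5|T5] := eqVneq #|T| 5.
  have od2 v : 2 <= outdeg e v by have := odp v; lia.
  have id2 v : 2 <= indeg e v by have := idp v; lia.
  by have [?|?] := dicycle4_free_order5 eI no4 od2 id2 degp T5; [left | do 4 right; left].
have [T6|T6] := eqVneq #|T| 6.
  have od2 v : 2 <= outdeg e v by have := odp v; lia.
  have id2 v : 2 <= indeg e v by have := idp v; lia.
  by have [?|[?|[?|?]]] := dicycle4_free_order6 eI no4 od2 id2 degp T6;
    [right; left | do 2 right; left | do 3 right; left | do 5 right].
exfalso; have T_gt0 : 0 < #|T| by lia.
(* This is [p/2 - 1] rounded up, at least 3 because [p > 6]. *)
pose s := (#|T|.-1)./2.
have s_gt2 : 2 < s by rewrite /s; lia.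
have ods v : s <= outdeg e v by have := odp v; rewrite /s; lia.
have ids v : s <= indeg e v by have := idp v; rewrite /s; lia.
apply: (no_far_pair_false eI no4 s_gt2 ods ids degp _ T_gt0) => z x zx nzx.
apply: not_farP => //; apply/negP => F.
have [Todd|Teven] := boolP (odd #|T|); last first.
  have cT : #|T| = 2 * s.+1 by rewrite /s; lia.
  apply: (far_pair_false cT eI no4 _ _ _ _ F) => // v.
  by rewrite -cT; apply: degp.
(* In odd order the disjoint sets [out e z] and [inn e x] have together at least [p - 1] vertices,
   yet avoid both [z] and [x]. *)
have /and3P[_ _ D] := F; move: D; rewrite -setI_eq0 => /eqP D0.
have sub : out e z :|: inn e x \subset ~: [set z; x].
  apply/subsetP => v; rewrite !inE => h; apply: contraL h => /orP[] /eqP ->.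
    by rewrite eI (negbTE nzx).
  by rewrite eI orbF.
have := subset_leq_card sub; rewrite cardsU D0 cards0 subn0.
have := cardsC [set z; x]; rewrite cards2 zx; have := odp z; have := idp x.
by rewrite /outdeg /indeg; lia.
Qed.

End Main.

Theorem theorem3 (T : finType) (e : rel T) (e_irr : irreflexive e)
    (p_ge5 : 5 <= #|T|)
    (deg_ge : #|T| - 1 <= min_degree e)
    (semideg_ge : (#|T|%:R / 2%:R - 1 <= (min_semidegree e)%:R :> rat)%R) :
  (has_dicycle e 3 \/
   (exists n : nat, #|T| = 2 * n /\
      iso_spanning_sub e (symdi (complete_bipartite n n))) \/
   diso e (symdi (cycle_graph 5)) \/
   (exists n : nat, #|T| = 2 * n + 1 /\
      diso e (symdi (complete_bipartite n (n + 1)))))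
  /\
  (has_dicycle e 4 \/
   diso e (symdi (cycle_graph 5)) \/
   diso e H6' \/
   diso e H6'' \/
   diso e C6_1 \/
   diso e (symdi (graph_join
      (graph_union (complete_graph 2) (complete_graph 2))
      (complete_graph 1))) \/
   in_H33 e).
Proof.
(* The rational bound is cleared of its denominator for use by [lia]. *)
have semi : #|T| <= 2 * min_semidegree e + 2.
  rewrite -(ler_nat rat) natrD natrM -lerBlDr -ler_pdivrMl ?ltr0n //.
  by rewrite mulrBr mulVf ?pnatr_eq0 // mulrC.
have semi_le v : min_semidegree e <= outdeg e v /\ min_semidegree e <= indeg e v.
  have := bigminn_le (fun v => minn (outdeg e v) (indeg e v)) #|T| v.
  by rewrite -/(min_semidegree e); lia.
have odp v : #|T| <= 2 * outdeg e v + 2 by have := semi_le v; lia.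
have idp v : #|T| <= 2 * indeg e v + 2 by have := semi_le v; lia.
have degp v : #|T| <= (deg e v).+1.
  by have := bigminn_le (deg e) (2 * #|T|) v; rewrite -/(min_degree e); lia.
split.
  have [|no3] := dicycle3_or_free e_irr; first by left.
  by right; apply: dicycle3_free_cases.
have [|no4] := dicycle4_or_free e_irr; first by left.
by right; apply: dicycle4_free_cases.
Qed.
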